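(* In the variable-assignment setting, suppose there is a function $\mu:\mathcal B\to[0,\infty)$ such that $$\forall B\in\mathcal B:\qquad \mu(B)\ \ge\ P_\Omega(B)\sum_{\substack{Y\subseteq \mathcal B\\ Y \text{ orderable to } B}}\ \prod_{B'\in Y}\mu(B').$$ Then the MT algorithm terminates with probability 1, and for every $B\in\mathcal B$ the expected number of times $B$ is resampled is at most $\mu(B)$.
   Context: Variable-assignment setting: there are variables $X_1,\dots,X_n$, each taking values in a finite set; $\Omega$ is the product distribution in which the variables are independent with $P_\Omega(X_i=j)=p_{ij}$. A bad-event is atomic: a finite set $B$ of pairs $(i,j)$ with distinct first coordinates, identified with the event $\bigwedge_{(i,j)\in B}(X_i=j)$. $\mathcal B$ is a finite set of bad-events, $m=|\mathcal B|$. For pairs, $(i,j)\sim(i',j')$ iff $i=i'$ and $j\neq j'$. For a pair $z$ and a set of pairs $B$, $z\sim B$ iff there is $z'\in B$ with $z\sim z'$. For a variable $i$, $i\sim B$ means $(i,j)\in B$ for some $j$. Orderable sets: given an event $E$ (a set of pairs), a set $Y\subseteq\mathcal B$ is orderable to $E$ if either (O1) $Y=\{E\}$, or (O2) $Y$ can be enumerated as $Y=\{B_1,\dots,B_s\}$ (distinct elements) so that for each $i=1,\dots,s$ there is $z_i\in E$ with $z_i\sim B_i$ and $z_i\not\sim B_1,\dots,z_i\not\sim B_{i-1}$. (In particular $\emptyset$ is orderable to $E$.) MT algorithm: (1) draw all variables independently from $\Omega$; (2) while some bad-event in $\mathcal B$ is true, choose a true bad-event $B$ and resample every variable $X_i$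 with $i\sim B$ independently from its $\Omega$-distribution. The choice of which true bad-event to resample is arbitrary, but may depend only on the current and past state of the algorithm, not on future random draws. *)

(* Defs.v *)
From HB Require Import structures.
From mathcomp Require Import all_boot all_order all_algebra.
Set Implicit Arguments. Unset Strict Implicit. Unset Printing Implicit Defensive.
Import Order.TTheory GRing.Theory Num.Theory.
Local Open Scope ring_scope.

Section MT.
Variables (I V : finType).

Definition assignment := {ffun I -> V}.
(* A pair (i,j) stands for "X_i = j"; an event is a finite set of pairs. *)
Definition event := {set (I * V)}.

Definition atomic (B : event) : bool :=
  [forall z in B, forall z' in B, (z.1 == z'.1) ==> (z == z')].

Definition simP (z z' : I * V) : bool := (z.1 == z'.1) && (z.2 != z'.2).
Definition simS (z : I * V) (B : event) : bool := [exists z' in B, simP z z'].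

Definition orderable (E : event) (Y : {set event}) : bool :=
  (Y == [set E]) ||
  [exists f : {ffun 'I_#|Y| -> event},
     [&& injectiveb f, [forall k, f k \in Y] &
         [forall k, [exists z in E,
            simS z (f k) && [forall l : 'I_#|Y|, (l < k)%N ==> ~~ simS z (f l)]]]]].

Variable R : archiRealFieldType.
Variable p : I -> V -> R.

(* P_Omega(B) for an atomic event B *)
Definition PO (B : event) : R := \prod_(z in B) p z.1 z.2.

Definition holds (x : assignment) (B : event) : bool := [forall z in B, x z.1 == z.2].

Definition some_bad (BB : {set event}) (x : assignment) : bool :=
  [exists B in BB, holds x B].

Definition resample (x : assignment) (B : event) (y : assignment) : assignment :=
  [ffun i => if [exists j, (i, j) \in B] then y i else x i].

(* MT run driven by the fresh draws r 0, r 1, ...: r 0 is the initial draw,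
   r (k+1) supplies the fresh values used at the (k+1)-st step.  The history
   is kept as a list of states, most recent first.  sel is the selection
   rule, applied to the full history (current state at the head). *)
Fixpoint hist (BB : {set event}) (sel : seq assignment -> event)
    (r : nat -> assignment) (k : nat) : seq assignment :=
  match k with
  | 0 => [:: r 0%N]
  | k'.+1 =>
      let h := hist BB sel r k' in
      let x := head (r 0%N) h in
      if some_bad BB x then resample x (sel h) (r k) :: h else x :: h
  end.

Definition cur BB sel r k : assignment := head (r 0%N) (hist BB sel r k).

Definition count_res BB sel r (B : event) (T : nat) : nat :=
  \sum_(k < T) (some_bad BB (cur BB sel r k) && (sel (hist BB sel r k) == B)).

Definition running BB sel r (T : nat) : bool := some_bad BB (cur BB sel r T).

(* probability space for the first T+1 draws: independent full assignments
   distributed according to Omega *)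
Definition weight T (r : {ffun 'I_T.+1 -> assignment}) : R :=
  \prod_(k < T.+1) \prod_(i : I) p i (r k i).

Definition draws T (r : {ffun 'I_T.+1 -> assignment}) : nat -> assignment :=
  fun k => r (inord k).

Definition Exp T (f : (nat -> assignment) -> nat) : R :=
  \sum_(r : {ffun 'I_T.+1 -> assignment}) weight r * (f (draws r))%:R.

End MT.

(* Main.v *)
Require Import Defs.
From HB Require Import structures.
From mathcomp Require Import all_boot all_order all_algebra.
Import Order.TTheory GRing.Theory Num.Theory.
Local Open Scope ring_scope.

(* Witness trees. Reading a run backwards from a resampling of B, each earlier
   resampled event C is attached below the deepest node whose children, together
   with C, remain orderable to its label. Call a variable-value pair required by
   a tree if it occurs in the deepest nodes mentioning its variable; the tree can
   only arise from a state in which all required pairs hold, for if C disagreed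
   with a required pair it would be attached even deeper. Hence
     sum over trees of (product of P(label)) / P(required pairs) * [required pairs hold]
   is a potential which, added to the number of resamplings of B so far, never
   increases in expectation (insertion is injective on trees, since a leaf
   labelled C is eligible for C again). Its initial expectation is at most the
   total weight of all trees with root B, and orderability of the sets of
   children together with the hypothesis on mu bounds this weight by mu B.
   Termination follows because running through time T costs T resamplings. *)

(** * Extending orderable sets by one event *)

Section Orderable.
Set Implicit Arguments.
Unset Strict Implicit.
Variables (I V : finType).
Implicit Types (z : I * V) (B C E : event I V) (Y : {set event I V}).

Definition mentions (i : I) B := [exists j, (i, j) \in B].

Lemma simS_mentions z B : simS z B -> mentions z.1 B.
Proof.
case/exists_inP=> [[i j]] zB /andP[/eqP/= -> _].
by apply/existsP; exists j.
Qed.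

Lemma mem_mentions z B : z \in B -> mentions z.1 B.
Proof. by case: z => i j zB; apply/existsP; exists j. Qed.

Lemma atomic_inj B i j j' : atomic B -> (i, j) \in B -> (i, j') \in B -> j = j'.
Proof.
move=> /forall_inP atB ijB ij'B.
by move/forall_inP/(_ _ ij'B)/implyP: (atB _ ijB) => /(_ (eqxx _)) /eqP[].
Qed.

Lemma simS_neq i j j' B : (i, j) \in B -> j' != j -> simS (i, j') B.
Proof. by move=> ijB j'j; apply/exists_inP; exists (i, j) => //; rewrite /simP eqxx. Qed.

Lemma orderable_self E : orderable E [set E].
Proof. by rewrite /orderable eqxx. Qed.

Lemma orderable0 E : orderable E set0.
Proof.
apply/orP; right; apply/existsP; exists [ffun=> E].
have no (k : 'I_#|@set0 (event I V)|) : False by case: k => k; rewrite cards0.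
by apply/and3P; split; [apply/injectiveP => k | apply/forallP => k | apply/forallP => k];
  case: (no k).
Qed.

(** [C] can be appended at the end of the enumeration of [Y], with [z] as its witness. The condition
    [E \notin Y] rules out the case (O1), where [Y] is [[set E]]. *)
Lemma orderableU1 E Y C z :
    orderable E Y -> E \notin Y -> C \notin Y ->
    z \in E -> simS z C -> (forall D, D \in Y -> ~~ simS z D) ->
  orderable E (C |: Y).
Proof.
move=> /orP[/eqP -> | /existsP[f /and3P[/injectiveP f_inj /forallP fY /forallP fP]]].
  by rewrite set11.
move=> _ CY zE zC zY; apply/orP; right.
have cY : #|C |: Y| = #|Y|.+1 by rewrite cardsU1 CY.
pose g (k : 'I_#|C |: Y|) : event I V :=
  if insub (k : nat) is Some k' then f k' else C.
have gY k (kY : (k < #|Y|)%N) kCY : g (Ordinal (m := k) kCY) = f (Ordinal kY).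
  by rewrite /g insubT.
have gC k kCY : (#|Y| <= k)%N -> g (Ordinal (m := k) kCY) = C.
  by move=> Yk; rewrite /g insubF //= ltnNge Yk.
apply/existsP; exists [ffun k => g k]; apply/and3P; split.
- apply/injectiveP => -[k1 k1P] [k2 k2P]; rewrite !ffunE => e; apply/val_inj => /=.
  have [k1Y|Yk1] := ltnP k1 #|Y|; have [k2Y|Yk2] := ltnP k2 #|Y|.
  + by move: e; rewrite (gY _ k1Y) (gY _ k2Y) => /f_inj [].
  + by move: CY; rewrite -(gC _ k2P Yk2) -e (gY _ k1Y) fY.
  + by move: CY; rewrite -(gC _ k1P Yk1) e (gY _ k2Y) fY.
  + apply/eqP; rewrite eqn_leq.
    by rewrite (leq_trans _ Yk2) ?(leq_trans _ Yk1) // -ltnS -cY.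
- apply/forallP => -[k kP]; rewrite ffunE in_setU1.
  have [kY|Yk] := ltnP k #|Y|; first by rewrite (gY _ kY) fY orbT.
  by rewrite gC ?eqxx.
- apply/forallP => -[k kP]; rewrite ffunE.
  have [kY|Yk] := ltnP k #|Y|.
    have /exists_inP[z' z'E /andP[z'k /forallP z'l]] := fP (Ordinal kY).
    apply/exists_inP; exists z' => //; rewrite (gY _ kY) z'k /=.
    apply/forallP => -[l lP]; apply/implyP => /= lk.
    rewrite ffunE (gY _ (ltn_trans lk kY)).
    exact: (implyP (z'l (Ordinal (ltn_trans lk kY)))).
  apply/exists_inP; exists z => //; rewrite gC // zC /=.
  apply/forallP => -[l lP]; apply/implyP => /= lk.
  have lY : (l < #|Y|)%N by apply: (leq_trans lk); rewrite -ltnS -cY.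
  by rewrite ffunE (gY _ lY) zY.
Qed.

End Orderable.

(** * Witness trees and the insertion of resampled events *)

Section WitnessTrees.
Set Implicit Arguments.
Unset Strict Implicit.
Variables (I V : finType) (N : nat) (BB : {set event I V}).
Hypothesis BB_atomic : forall B, B \in BB -> atomic B.
Local Notation ev := (event I V).
Local Notation node := (N.-bseq ev).
Implicit Types (B C : ev) (u v w : node) (tau : {set node}) (n : nat).

(* A node is the path of labels leading to it, read from the node up to the root. *)
Definition child C v : node := insub_bseq N (C :: v).
Definition root_node B : node := insub_bseq N [:: B].
Definition label v : ev := head set0 v.
Definition kids tau v : {set ev} := [set C | child C v \in tau].

(** Siblings carry distinct labels, so a path of labels identifies a node and a tree is a set of
    paths; the bound [N] makes trees a finite type. Positive size excludes the empty path, the value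
    of [child] on overflow. *)
Definition wtree n B tau :=
  [&& root_node B \in tau &
   [forall v in tau, [&& (0 < size v <= n)%N, label v \in BB,
      orderable (label v) (kids tau v) &
      (v == root_node B) || [exists u in tau, v == child (label v) u]]]].

Definition eligible tau C v :=
  [&& v \in tau, C \notin kids tau v & orderable (label v) (C |: kids tau v)].

Definition insert tau C : {set node} :=
  if [pick v | eligible tau C v &
        [forall u, eligible tau C u ==> (size u <= size v)%N]] is Some v
  then child C v |: tau else tau.

Definition deepest tau (i : I) v :=
  (v \in tau) && [forall u in tau, mentions i (label u) ==> (size u <= size v)%N].

Definition req tau : event I V :=
  [set z | [exists v, deepest tau z.1 v && (z \in label v)]].

(** Several deepest nodes may mention the same variable; atomicity of [req tau] says that they agree
    on its value. *)
Definition witness n B tau := wtree n B tau && atomic (req tau).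

Lemma val_child C v : (size v < N)%N -> child C v = C :: v :> seq ev.
Proof. by move=> vN; rewrite /child /insub_bseq val_insubd /= vN. Qed.

Lemma val_child_overflow C v : (N <= size v)%N -> child C v = [::] :> seq ev.
Proof. by move=> Nv; rewrite /child /insub_bseq val_insubd /= ltnNge Nv. Qed.

Lemma val_root_node B : (0 < N)%N -> root_node B = [:: B] :> seq ev.
Proof. by move=> N0; rewrite /root_node /insub_bseq val_insubd /= N0. Qed.

Lemma label_child C v : (size v < N)%N -> label (child C v) = C.
Proof. by move=> vN; rewrite /label val_child. Qed.

Lemma child_inj C C' v v' : (size v < N)%N -> (size v' < N)%N ->
  child C v = child C' v' -> C = C' /\ v = v'.
Proof.
move=> vN v'N /(congr1 (@bseqval N ev)); rewrite !val_child // => -[-> e].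
by split=> //; apply: val_inj.
Qed.

Variant insert_spec tau C : {set node} -> Prop :=
| InsNo of (forall v, ~~ eligible tau C v) : insert_spec tau C tau
| InsYes v of eligible tau C v & (forall u, eligible tau C u -> (size u <= size v)%N) :
    insert_spec tau C (child C v |: tau).

Lemma insertP tau C : insert_spec tau C (insert tau C).
Proof.
rewrite /insert; case: pickP => [v /andP[vE /forallP vm]|no].
  by constructor=> // u; apply/implyP.
constructor=> v; apply/negP => vE.
have [u uE um] := arg_maxnP (fun u : node => size u) vE.
by move: (no u); rewrite uE /=; case/forallP => w; apply/implyP => wE; apply: um.
Qed.

Section Fixed.
Variables (n : nat) (B : ev) (tau : {set node}).
Hypothesis tauW : wtree n B tau.

Lemma wtree_root : root_node B \in tau. Proof. by case/andP: tauW. Qed.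
Lemma wtree_size v : v \in tau -> (0 < size v <= n)%N.
Proof. by move=> vt; case/andP: tauW => _ /forall_inP/(_ v vt)/and4P[]. Qed.
Lemma wtree_label v : v \in tau -> label v \in BB.
Proof. by move=> vt; case/andP: tauW => _ /forall_inP/(_ v vt)/and4P[]. Qed.
Lemma wtree_orderable v : v \in tau -> orderable (label v) (kids tau v).
Proof. by move=> vt; case/andP: tauW => _ /forall_inP/(_ v vt)/and4P[]. Qed.
Lemma wtree_parent v : v \in tau -> v != root_node B ->
  exists2 u, u \in tau & v = child (label v) u.
Proof.
move=> vt vr; case/andP: tauW => _ /forall_inP/(_ v vt)/and4P[_ _ _].
by rewrite (negPf vr) => /exists_inP[u ut /eqP e]; exists u.
Qed.

Hypothesis nN : (n < N)%N.

Let ltN v : v \in tau -> (size v < N)%N.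
Proof. by move=> /wtree_size/andP[_ vn]; apply: leq_ltn_trans nN. Qed.

(** A kid of [v] mentioning the variable of [z] would be deeper than [v]. Hence no kid conflicts
    with [z], neither [C] nor the label of [v] is a kid, and [z] lets [C] be appended to the
    kids. *)
Lemma eligible_deepest z v C :
  deepest tau z.1 v -> z \in label v -> simS z C -> eligible tau C v.
Proof.
move=> /andP[vt /forall_inP vd] zv zC.
have nok D : mentions z.1 D -> D \notin kids tau v.
  move=> zD; rewrite inE; apply/negP => /vd.
  by rewrite label_child ?ltN // zD val_child ?ltN //= ltnn.
have Cn : C \notin kids tau v by apply/nok/simS_mentions.
apply/and3P; split=> //.
apply: (orderableU1 (wtree_orderable vt) _ Cn zv zC).
  exact/nok/mem_mentions.
by move=> D; apply: contraTN => /simS_mentions; apply: nok.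
Qed.

Lemma mem_child v C : v != [::] :> seq ev -> child C v \in tau -> v \in tau.
Proof.
move=> v0 Cv.
have vN : (size v < N)%N.
  rewrite ltnNge; apply/negP => Nv.
  by have := wtree_size Cv; rewrite val_child_overflow.
have N0 : (0 < N)%N by apply: leq_ltn_trans vN.
have Cr : child C v != root_node B.
  apply: contra v0 => /eqP/(congr1 (@bseqval N ev)).
  by rewrite val_child // val_root_node // => -[_ ->].
have [u ut e] := wtree_parent Cv Cr.
by have [_ ->] := child_inj vN (ltN ut) e.
Qed.

Lemma kids_ins v C w : v \in tau -> w \in tau ->
  kids (child C v |: tau) w = if w == v then C |: kids tau w else kids tau w.
Proof.
move=> vt wt; apply/setP => D; rewrite (fun_if (fun A : {set ev} => D \in A)) !inE.
have [->|wv] := eqVneq w v.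
  by congr (_ || _); apply/eqP/eqP => [/child_inj[]|->]; rewrite ?ltN.
by rewrite orb_idl // => /eqP/child_inj[]; rewrite ?ltN // => _ /eqP; rewrite (negPf wv).
Qed.

Lemma kids_ins_new v C : v \in tau -> child C v \notin tau ->
  kids (child C v |: tau) (child C v) = set0.
Proof.
move=> vt Cv; apply/setP => D; rewrite !inE.
have vN := ltN vt.
have v0 : child C v != [::] :> seq ev by rewrite val_child.
have -> : (child D (child C v) \in tau) = false.
  by apply: contraNF Cv => /(mem_child v0).
rewrite orbF; apply/negP => /eqP/(congr1 (size \o @bseqval N ev)) /=.
(* The sizes differ in either case: by one below the bound, while at the bound [child] overflows to
   the empty path. *)
have [uN|Nu] := ltnP (size (child C v)) N.
  by rewrite [in LHS]val_child //= => /esym/n_Sn.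
by rewrite [in LHS]val_child_overflow //= val_child.
Qed.

Lemma wtree_ins C : C \in BB -> wtree n.+1 B (insert tau C).
Proof.
move=> CB; case: insertP => [_|v /and3P[vt Cv Cor] _].
  apply/andP; split; first exact: wtree_root.
  apply/forall_inP => v vt; have /andP[v0 vn] := wtree_size vt.
  rewrite v0 (leqW vn) (wtree_label vt) (wtree_orderable vt) /=.
  by case/andP: tauW => _ /forall_inP/(_ v vt)/and4P[].
have vN := ltN vt; move: Cv; rewrite inE => Cv.
apply/andP; split; first by rewrite inE wtree_root orbT.
apply/forall_inP => w /setU1P[->|wt].
  rewrite kids_ins_new // orderable0 label_child // CB val_child //= ltnS.
  case/andP: (wtree_size vt) => _ -> /=.
  by apply/orP; right; apply/exists_inP; exists v => //; rewrite inE vt orbT.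
have /andP[w0 wn] := wtree_size wt.
rewrite w0 (leqW wn) (wtree_label wt) kids_ins //=; apply/andP; split.
  by case: eqVneq => [->|_] //; apply: wtree_orderable.
have [//|wr /=] := eqVneq w (root_node B).
have [u ut e] := wtree_parent wt wr.
by apply/exists_inP; exists u; rewrite ?inE ?ut ?orbT //; apply/eqP.
Qed.

Lemma eligible_leaf v C : v \in tau -> label v = C -> kids tau v = set0 ->
  eligible tau C v.
Proof.
by move=> vt <- k0; rewrite /eligible vt k0 inE setU0 orderable_self.
Qed.

Lemma deepest_exists i v : v \in tau -> mentions i (label v) ->
  exists2 w, deepest tau i w & mentions i (label w).
Proof.
move=> vt vi.
pose P u := (u \in tau) && mentions i (label u).
have Pv : P v by rewrite /P vt.
have [w /andP[wt wi] wm] := arg_maxnP (fun u : node => size u) Pv.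
exists w => //; rewrite /deepest wt /=.
by apply/forall_inP => u ut; apply/implyP => ui; apply: wm; rewrite /P ut.
Qed.

(** On a variable of [C], a deepest node of [tau] that disagrees with [C] is eligible, hence no
    deeper than [v], and the new node is strictly deeper. So the requirements on this variable
    become those of [C]; on other variables nothing changes. *)
Lemma req_ins C v : eligible tau C v ->
    (forall u, eligible tau C u -> (size u <= size v)%N) ->
  req (child C v |: tau) = C :|: [set z in req tau | ~~ mentions z.1 C].
Proof.
move=> /and3P[vt Cv _] vm; have vN := ltN vt.
have lc := label_child C vN; have sc : size (child C v) = (size v).+1 by rewrite val_child.
apply/setP => z; rewrite !inE.
have [zC|zC] := boolP (mentions z.1 C); last first.
  have -> : (z \in C) = false by apply: contraNF zC => /mem_mentions.
  rewrite andbT /=; apply: eq_existsb => w; rewrite /deepest in_setU1 andbC [RHS]andbC.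
  have [zw|//] := boolP (z \in label w); rewrite !andTb.
  have -> : (w == child C v) = false.
    by apply: contraNF zC => /eqP e; rewrite -lc -e; apply: mem_mentions.
  rewrite orFb; congr (_ && _).
  apply/forall_inP/forall_inP => H u; first by move=> ut; apply: H; rewrite in_setU1 ut orbT.
  by case/setU1P => [->|]; [rewrite lc (negPf zC)|apply: H].
rewrite andbF orbF; apply/existsP/idP => [[w /andP[/andP[]]]|zinC].
  rewrite in_setU1 => /orP[/eqP -> _|wt /forall_inP wd zw]; first by rewrite lc.
  case: z zC zw wd => i j /= /existsP[j' ijC] zw wd.
  have [->//|jj'] := eqVneq j j'.
  have wdeep : deepest tau i w.
    by rewrite /deepest wt; apply/forall_inP => u ut; apply: wd; rewrite in_setU1 ut orbT.
  have /vm wv := eligible_deepest (z := (i, j)) wdeep zw (simS_neq ijC jj').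
  have := wd _ (setU11 _ _); rewrite lc sc => /implyP.
  by move=> /(_ (mem_mentions ijC)); rewrite ltnNge wv.
case: z zC zinC => i j /= iC zinC.
have [/existsP[u /andP[ut ui]]|none] := boolP [exists u, (u \in tau) && mentions i (label u)].
  have [w wd /existsP[j' zw]] := deepest_exists ut ui.
  have /andP[wt /forall_inP wm] := wd.
  (* If [w] is no deeper than [v], the new node becomes deepest; otherwise [w] stays deepest and
     must agree with [C], by maximality of [v]. *)
  have [lt|ge] := leqP (size w) (size v).
    exists (child C v); rewrite /deepest setU11 lc zinC andbT /=.
    apply/forall_inP => x /setU1P[-> |xt]; first by rewrite leqnn implybT.
    apply/implyP => xi; rewrite sc ltnW // ltnS (leq_trans _ lt) //.
    exact: (implyP (wm x xt)).
  have [e|jj'] := eqVneq j' j.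
    exists w; rewrite /deepest in_setU1 wt orbT -e zw andbT /=.
    by apply/forall_inP => x /setU1P[-> |]; [rewrite sc ge implybT|apply: wm].
  by have := vm _ (eligible_deepest (z := (i, j')) wd zw (simS_neq zinC jj')); rewrite leqNgt ge.
exists (child C v); rewrite /deepest setU11 lc zinC andbT /=.
apply/forall_inP => x /setU1P[-> |xt]; first by rewrite leqnn implybT.
by apply/implyP => xi; case/negP: none; apply/existsP; exists x; rewrite xt.
Qed.

Lemma req_not_eligible C z : (forall v, ~~ eligible tau C v) ->
  z \in req tau -> mentions z.1 C -> z \in C.
Proof.
move=> no; rewrite inE; case: z => i j /existsP[v /andP[vd zv]] /existsP[j' zC].
have [->//|jj'] := eqVneq j j'.
have := eligible_deepest (z := (i, j)) vd zv (simS_neq zC jj').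
by rewrite (negPf (no v)).
Qed.

End Fixed.

Lemma witness_ins n B tau C : (n < N)%N -> C \in BB -> witness n B tau ->
  witness n.+1 B (insert tau C).
Proof.
move=> nN CB /andP[tauW tauA]; rewrite /witness wtree_ins //=.
case: insertP => // v vE vm; rewrite (req_ins tauW) //.
apply/forall_inP => -[i j] zQ; apply/forall_inP => -[i' j'] zQ'.
apply/implyP => /= /eqP e; subst i'; apply/eqP; congr pair.
move: zQ zQ'; rewrite !inE /= => /orP[zC|/andP[zQ zC]] /orP[zC'|/andP[zQ' zC']].
- exact: atomic_inj (BB_atomic CB) zC zC'.
- by rewrite (mem_mentions zC) in zC'.
- by rewrite (mem_mentions zC') in zC.
- by apply: (atomic_inj tauA); rewrite inE; [apply: zQ|apply: zQ'].
Qed.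

Lemma wtreeS n B tau : wtree n B tau -> wtree n.+1 B tau.
Proof.
case/andP=> rt /forall_inP tauW; apply/andP; split=> //.
by apply/forall_inP => v /tauW/and4P[/andP[-> /leqW ->] -> -> ->].
Qed.

Lemma witnessS n B tau : witness n B tau -> witness n.+1 B tau.
Proof. by case/andP=> tauW tauA; rewrite /witness wtreeS. Qed.

(** If the two new leaves differ, each already is a leaf of the other tree and eligible for [C]
    there, so maximality makes each of [v], [v'] strictly deeper than the other. If only one tree
    grows, its new leaf is present and eligible in the unchanged one. *)
Lemma insert_inj n B C tau tau' : (n < N)%N -> wtree n B tau -> wtree n B tau' ->
  insert tau C = insert tau' C -> tau = tau'.
Proof.
move=> nN tW tW'.
have new n' t (W : wtree n' B t) (n'N : (n' < N)%N) v : eligible t C v ->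
    child C v \notin t /\ (size v < N)%N.
  move=> /and3P[vt]; rewrite inE => -> _; split=> //.
  by case/andP: (wtree_size W vt) => _ vn; apply: leq_ltn_trans n'N.
(* A freshly inserted leaf labelled [C] is eligible for [C] again by (O1). *)
have leaf t t' v : wtree n B t -> wtree n B t' -> eligible t C v ->
    child C v \in t' -> t' \subset child C v |: t -> eligible t' C (child C v).
  move=> W W' vE ct' sub; have [cv vN] := new _ _ W nN _ vE.
  have vt : v \in t by case/and3P: vE.
  apply: (eligible_leaf ct'); first exact: label_child.
  apply/eqP; rewrite -subset0 -(kids_ins_new W nN vt cv).
  by apply/subsetP => D; rewrite !(in_set (fun _ => child _ _ \in _)) => /(subsetP sub).
case: insertP => [no|v vE vm]; case: insertP => [no'|v' vE' vm'] //.
- move=> e; case/negP: (no (child C v')).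
  by apply: (leaf _ _ _ tW' tW vE'); rewrite e ?setU11.
- move=> e; case/negP: (no' (child C v)).
  by apply: (leaf _ _ _ tW tW' vE); rewrite -e ?setU11.
move=> e; have [cv vN] := new _ _ tW nN _ vE; have [cv' vN'] := new _ _ tW' nN _ vE'.
have [ee|ne] := eqVneq (child C v) (child C v').
  by rewrite -(setU1K cv) e ee setU1K.
have c't : child C v' \in tau.
  by have := setU11 (child C v') tau'; rewrite -e in_setU1 eq_sym (negPf ne).
have ct' : child C v \in tau'.
  by have := setU11 (child C v) tau; rewrite e in_setU1 (negPf ne).
have E1 : eligible tau C (child C v').
  by apply: (leaf _ _ _ tW' tW vE') => //; rewrite -e subsetU1.
have E2 : eligible tau' C (child C v).
  by apply: (leaf _ _ _ tW tW' vE) => //; rewrite e subsetU1.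
have := vm _ E1; have := vm' _ E2; rewrite !val_child //= => l1 l2.
by have := ltn_trans l1 l2; rewrite ltnn.
Qed.

Lemma wtree_leaf n B : (n < N)%N -> B \in BB -> wtree n.+1 B [set root_node B].
Proof.
move=> nN BB_B; have N0 : (0 < N)%N by apply: leq_ltn_trans nN.
rewrite /wtree set11; apply/forall_inP => v /set1P ->.
have -> : label (root_node B) = B by rewrite /label val_root_node.
have -> : kids [set root_node B] (root_node B) = set0.
  apply/setP => D; rewrite !inE; apply/negP => /eqP/(congr1 (size \o @bseqval N ev)) /=.
  by rewrite /child /insub_bseq val_insubd /= val_root_node //=; case: ifP.
by rewrite val_root_node //= BB_B orderable0 eqxx.
Qed.

Lemma req_leaf B : (0 < N)%N -> req [set root_node B] = B.
Proof.
move=> N0; have lr : label (root_node B) = B by rewrite /label val_root_node.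
apply/setP => z; rewrite inE; apply/existsP/idP => [[v /andP[/andP[/set1P ->]]]|zB].
  by rewrite lr.
exists (root_node B); rewrite lr zB /deepest set11 andbT.
by apply/forall_inP => u /set1P ->; rewrite leqnn implybT.
Qed.

Lemma witness_leaf n B : (n < N)%N -> B \in BB -> witness n.+1 B [set root_node B].
Proof.
move=> nN BB_B; rewrite /witness wtree_leaf // req_leaf ?BB_atomic //.
exact: leq_ltn_trans nN.
Qed.

(** Keeps the single root outside the image of the insertion of [B], free to pay for the resampling
    of [B] itself. A lone root is eligible for [B] by (O1), so it cannot stay unchanged. *)
Lemma insert_neq_leaf n B tau : (n < N)%N -> wtree n B tau -> insert tau B != [set root_node B].
Proof.
move=> nN tauW; have rt := wtree_root tauW; have N0 : (0 < N)%N by apply: leq_ltn_trans nN.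
apply/eqP; case: insertP => [no e|v /and3P[vt]].
  have n0 : (0 < n)%N by case/andP: (wtree_size tauW rt) => r0; apply: leq_trans.
  case/negP: (no (root_node B)); apply: eligible_leaf => //; first by rewrite /label val_root_node.
  apply/setP => D; rewrite !inE e inE.
  apply/negP => /eqP/(congr1 (size \o @bseqval N ev)) /=.
  by rewrite /child /insub_bseq val_insubd /= val_root_node //=; case: ifP.
rewrite inE => /negP cv _ _ e; apply: cv.
by have := setU11 (child B v) tau; rewrite {1}e => /set1P ->.
Qed.

End WitnessTrees.

(** * Sums compared along injections, and the total weight of witness trees *)

Lemma ler_sum_inj (R : numDomainType) (S S' : finType) (A : pred S) (A' : pred S')
    (g : S -> S') (F : S -> R) (G : S' -> R) :
    {in A &, injective g} -> (forall s, A s -> A' (g s)) ->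
    (forall s, A s -> F s <= G (g s)) -> (forall s', A' s' -> 0 <= G s') ->
  \sum_(s | A s) F s <= \sum_(s' | A' s') G s'.
Proof.
move=> g_inj gA FG G0; apply: (le_trans (ler_sum _ FG)).
rewrite -(big_imset G g_inj) [leRHS](bigID (mem (g @: A))) /=.
rewrite (eq_bigl (fun s' => A' s' && (s' \in g @: A))); last first.
  by move=> s'; rewrite andb_idl // => /imsetP[s /gA As ->].
by rewrite lerDl sumr_ge0 // => s' /andP[/G0].
Qed.

Arguments ler_sum_inj {R S S' A A'} g {F G}.

Section TreeSum.
Set Implicit Arguments.
Unset Strict Implicit.
Variables (I V : finType) (N : nat) (R : archiRealFieldType) (p : I -> V -> R).
Hypothesis p_ge0 : forall i j, 0 <= p i j.
Variables (BB : {set event I V}) (mu : event I V -> R).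
Hypothesis mu_ge0 : forall B, B \in BB -> 0 <= mu B.
Hypothesis Hmu : forall B, B \in BB ->
  PO p B * \sum_(Y in powerset BB | orderable B Y) \prod_(B' in Y) mu B' <= mu B.
Local Notation node := (N.-bseq (event I V)).
Local Notation tree := {set node}.
Implicit Types (v u : node) (tau : tree) (B C : event I V).

Lemma PO_ge0 B : 0 <= PO p B.
Proof. exact: prodr_ge0. Qed.

Definition tweight tau : R := \prod_(v in tau) PO p (label v).

(* Weight in which the nodes of the last level [n] count with [mu] rather than
   with their probability: it does not increase in total when a level is added. *)
Definition level_weight n tau : R :=
  \prod_(v in tau) (if (size v < n)%N then PO p (label v) else mu (label v)).

Definition trunc n tau : tree := [set v in tau | (size v <= n)%N].

Lemma tweight_ge0 tau : 0 <= tweight tau.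
Proof. by apply: prodr_ge0 => v _; apply: PO_ge0. Qed.

Lemma level_weight_ge0 n m B tau : wtree BB m B tau -> 0 <= level_weight n tau.
Proof.
move=> tW; apply: prodr_ge0 => v vt; case: ifP => _; first exact: PO_ge0.
exact/mu_ge0/(wtree_label tW).
Qed.

Lemma tweight_level n m B tau : wtree BB m B tau -> (m < n)%N ->
  tweight tau = level_weight n tau.
Proof.
move=> tW mn; apply: eq_bigr => v /(wtree_size tW)/andP[_ vm].
by rewrite (leq_ltn_trans vm mn).
Qed.

Section Step.
Variables (n : nat) (B : event I V).
Hypotheses (n0 : (0 < n)%N) (nN : (n < N)%N).

Lemma kids_trunc tau v : (size v < N)%N ->
  kids (trunc n tau) v = if (size v < n)%N then kids tau v else set0.
Proof.
move=> vN; apply/setP => C; rewrite (fun_if (fun A : {set _} => C \in A)) !inE.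
by rewrite val_child //=; case: ifP; rewrite ?andbT ?andbF.
Qed.

Lemma wtree_trunc tau : wtree BB n.+1 B tau -> wtree BB n B (trunc n tau).
Proof.
move=> tW; have rt := wtree_root tW.
apply/andP; split.
  by rewrite inE rt val_root_node // (leq_ltn_trans _ nN).
apply/forall_inP => v; rewrite inE => /andP[vt vn].
have /andP[-> _] := wtree_size tW vt; rewrite vn (wtree_label tW vt) /=.
rewrite kids_trunc ?(leq_ltn_trans vn nN) //; apply/andP; split.
  by case: ifP => _; [apply: (wtree_orderable tW)|apply: orderable0].
have [//|/(wtree_parent tW vt)[u ut e]] := eqVneq v (root_node N B).
apply/exists_inP; exists u; last exact/eqP.
rewrite inE ut /=; have [uN|Nu] := ltnP (size u) N.
  by rewrite (leq_trans _ vn) // e val_child //=.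
have /andP[] := wtree_size tW vt.
by rewrite {1}e val_child_overflow.
Qed.

Definition last_level tau : {set node} := [set v in tau | size v == n].

(** The value [set0] away from the last level puts these families into a [pfamily], the index set in
    the distributivity of products over sums. *)
Definition last_kids tau : {ffun node -> {set event I V}} :=
  [ffun v => if v \in last_level (trunc n tau) then kids tau v else set0].

Definition parent v : node := insub_bseq N (behead v).

Lemma parent_child C v : (size v < N)%N -> parent (child C v) = v.
Proof.
move=> vN; apply: val_inj => /=; rewrite /parent /insub_bseq val_insubd.
by rewrite val_child //= ltnW.
Qed.

Lemma top_node tau v : wtree BB n.+1 B tau -> v \in tau -> (n < size v)%N ->
  exists2 u, u \in last_level (trunc n tau) & v = child (label v) u.
Proof.
move=> tW vt nv.
have vr : v != root_node N B.
  by apply: contraTneq nv => ->; rewrite val_root_node ?(leq_ltn_trans _ nN) //= -leqNgt.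
have [u ut e] := wtree_parent tW vt vr; exists u => //.
have /andP[_] := wtree_size tW vt.
rewrite leq_eqVlt (ltnNge (size v)) nv orbF => /eqP sv.
have uN : (size u < N)%N.
  by rewrite ltnNge; apply/negP => Nu; move: nv; rewrite e val_child_overflow.
by move: sv; rewrite {1}e val_child //= => -[su]; rewrite !inE ut su leqnn eqxx.
Qed.

Lemma last_kids_inj tau tau' : wtree BB n.+1 B tau -> wtree BB n.+1 B tau' ->
  trunc n tau = trunc n tau' -> last_kids tau = last_kids tau' -> tau \subset tau'.
Proof.
move=> tW tW' te ke; apply/subsetP => v vt.
have [vn|nv] := leqP (size v) n.
  have : v \in trunc n tau by rewrite inE vt.
  by rewrite te inE => /andP[].
have [u ul e] := top_node tW vt nv.
have : label v \in last_kids tau u by rewrite ffunE ul inE -e.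
by rewrite ke ffunE -te ul inE -e.
Qed.

(** Nodes of the new level are grouped by their parent and then indexed by their label. *)
Lemma level_weightS tau : wtree BB n.+1 B tau ->
  level_weight n.+1 tau =
   \prod_(v in trunc n tau | (size v < n)%N) PO p (label v) *
   \prod_(v in last_level (trunc n tau))
      (PO p (label v) * \prod_(C in last_kids tau v) mu C).
Proof.
move=> tW; rewrite big_split /= mulrA.
rewrite /level_weight (bigID (fun v : node => (size v <= n)%N)) /=; congr (_ * _).
  rewrite (bigID (fun v : node => (size v < n)%N)) /=; congr (_ * _).
    apply: eq_big => [v|v /andP[/andP[_ vn] _]]; last by rewrite ltnS vn.
    by rewrite !inE.
  apply: eq_big => [v|v /andP[/andP[_ vn] _]]; last by rewrite ltnS vn.
  by rewrite !inE -!andbA -leqNgt; case: (v \in tau) => //=; rewrite eqn_leq andbA andbb.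
rewrite (partition_big parent (mem (last_level (trunc n tau)))) /=; last first.
  move=> v /andP[vt]; rewrite -ltnNge => nv.
  have [u ul e] := top_node tW vt nv.
  rewrite e parent_child //; move: ul; rewrite !inE => /andP[_ /eqP->]; exact: nN.
apply: eq_bigr => u ul.
have su : size u = n by apply/eqP; move: ul; rewrite inE => /andP[].
have uN : (size u < N)%N by rewrite su.
rewrite (reindex_onto (fun C => child C u) (@label I V N)) /=; last first.
  move=> v /andP[/andP[vt]]; rewrite -ltnNge => nv /eqP pv.
  have [u' ul' e] := top_node tW vt nv; rewrite -pv {2}e.
  rewrite parent_child -?e //.
  by move: ul'; rewrite inE => /andP[_ /eqP->].
apply: eq_big => [C|C _].
  by rewrite label_child // val_child //= su parent_child // ltnn !eqxx !andbT ffunE ul inE.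
by rewrite label_child // val_child //= su ltnn.
Qed.

(** For a fixed truncation, the trees inject into families of orderable sets, one set per node of
    the last level. The sum over families factors over these nodes, and the hypothesis on [mu]
    bounds each factor by [mu] of the label. *)
Lemma level_sum :
  \sum_(tau | wtree BB n.+1 B tau) level_weight n.+1 tau <=
  \sum_(tau | wtree BB n B tau) level_weight n tau.
Proof.
rewrite (partition_big (trunc n) (wtree BB n B)) /=; last exact: wtree_trunc.
apply: ler_sum => tau0 tW0.
pose D := last_level tau0.
pose c0 := \prod_(v in tau0 | (size v < n)%N) PO p (label v).
pose Q (v : node) := [pred Y | (Y \in powerset BB) && orderable (label v) Y].
pose G (g : {ffun node -> {set event I V}}) :=
  c0 * \prod_(v in D) (PO p (label v) * \prod_(C in g v) mu C).
have c0_ge0 : 0 <= c0 by apply: prodr_ge0 => v _; apply: PO_ge0.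
have Dsub v : v \in D -> v \in tau0 by rewrite inE => /andP[].
apply: (@le_trans _ _ (\sum_(g in pfamily set0 (mem D) Q) G g)).
  apply: (ler_sum_inj last_kids).
  - move=> t t' /andP[tW /eqP te] /andP[tW' /eqP te'] ke.
    apply/eqP; rewrite eqEsubset.
    by rewrite !last_kids_inj ?te ?te'.
  - move=> t /andP[tW /eqP te]; apply/pfamilyP; split.
      by apply/subsetP => v; rewrite inE ffunE te; case: ifP; rewrite ?eqxx.
    move=> v vD; rewrite ffunE te vD inE /=.
    have vt0 := Dsub v vD; have /andP[_ vn] := wtree_size tW0 vt0.
    have vt : v \in t by move: vt0; rewrite -te inE => /andP[].
    rewrite powersetE (wtree_orderable tW vt) andbT.
    apply/subsetP => C; rewrite inE => /(wtree_label tW).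
    by rewrite label_child // (leq_ltn_trans vn).
  - by move=> t /andP[tW /eqP te]; rewrite (level_weightS tW) te.
  move=> g /pfamilyP[_ gQ]; apply: mulr_ge0 => //.
  apply: prodr_ge0 => v /gQ /andP[gB _].
  rewrite mulr_ge0 ?PO_ge0 // prodr_ge0 // => C Cg; apply: mu_ge0.
  by move: gB; rewrite powersetE => /subsetP; apply.
rewrite -mulr_sumr -(big_distr_big_dep set0 (mem D) Q
  (fun v Y => PO p (label v) * \prod_(C in Y) mu C)) /=.
rewrite /level_weight [leRHS](bigID (fun v : node => (size v < n)%N)) /=.
apply: ler_pM => //.
- apply: prodr_ge0 => v vD; apply: sumr_ge0 => Y /andP[YB _].
  rewrite mulr_ge0 ?PO_ge0 // prodr_ge0 // => C CY; apply: mu_ge0.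
  by move: YB; rewrite powersetE => /subsetP; apply.
- by rewrite le_eqVlt; apply/orP; left; apply/eqP; apply: eq_bigr => v /andP[_ ->].
rewrite [leRHS](eq_big (mem D) (fun v => mu (label v))).
- apply: ler_prod => v vD; rewrite -mulr_sumr Hmu ?(wtree_label tW0) ?Dsub // andbT.
  rewrite mulr_ge0 ?PO_ge0 // sumr_ge0 // => Y /andP[YB _].
  rewrite prodr_ge0 // => C CY; apply: mu_ge0.
  by move: YB; rewrite powersetE => /subsetP; apply.
- move=> v; rewrite inE /D inE; have [vt|//] := boolP (v \in tau0).
  by have /andP[_ vn] := wtree_size tW0 vt; rewrite -leqNgt eqn_leq vn.
by move=> v /andP[_ /negPf ->].
Qed.

End Step.

Lemma level1_sum B : (0 < N)%N -> B \in BB ->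
  \sum_(tau | wtree BB 1 B tau) level_weight 1 tau = mu B.
Proof.
move=> N0 BB_B; rewrite (big_pred1 [set root_node N B]) => [|tau].
  by rewrite /level_weight big_set1 val_root_node //= /label val_root_node.
apply/idP/eqP => [tW|->]; last exact: wtree_leaf.
apply/setP => v; rewrite inE; apply/idP/eqP => [vt|->]; last exact: wtree_root tW.
apply/eqP; apply: contraT => /(wtree_parent tW vt)[u ut e].
have /andP[u0 _] := wtree_size tW ut; have /andP[] := wtree_size tW vt.
have [uN|Nu] := ltnP (size u) N; last by rewrite {1}e val_child_overflow.
by move=> _; rewrite {1}e val_child //= ltnS leqNgt u0.
Qed.

Lemma sum_tweight n B : (n < N)%N -> B \in BB ->
  \sum_(tau : tree | wtree BB n B tau) tweight tau <= mu B.
Proof.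
move=> nN BB_B.
have H m : (m < N)%N -> \sum_(tau | wtree BB m.+1 B tau) level_weight m.+1 tau <= mu B.
  elim: m => [|m IH] mN; first by rewrite level1_sum.
  exact: le_trans (level_sum _ _ mN) (IH (ltnW mN)).
(* With height at most [n], no node reaches level [n.+1], where [mu] would replace the
   probability. *)
apply: le_trans (H n nN); apply: (ler_sum_inj id) => //.
- by move=> tau; apply: wtreeS.
- by move=> tau tW; rewrite (tweight_level tW (ltnSn n)).
by move=> tau; apply: level_weight_ge0.
Qed.

End TreeSum.

(** * The potential of a state and its behaviour under resampling *)

Lemma forall_in_prod (R : comNzRingType) (S : finType) (A : {pred S}) (P : pred S) :
  ([forall z in A, P z])%:R = \prod_(z in A) (P z)%:R :> R.
Proof.
case: forall_inP => [H|nH]; first by rewrite big1 // => z /H ->.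
have [z zA zP] : exists2 z, z \in A & ~~ P z.
  apply/exists_inP; rewrite -negb_forall_in; apply/negP => /forall_inP; exact: nH.
by rewrite (bigD1 z) //= (negPf zP) mul0r.
Qed.

Section Potential.
Set Implicit Arguments.
Unset Strict Implicit.
Variables (I V : finType) (N : nat) (R : archiRealFieldType) (p : I -> V -> R).
Hypothesis p_ge0 : forall i j, 0 <= p i j.
Hypothesis p_sum1 : forall i, \sum_(j : V) p i j = 1.
Variables (BB : {set event I V}) (mu : event I V -> R).
Hypothesis BB_atomic : forall B, B \in BB -> atomic B.
Hypothesis mu_ge0 : forall B, B \in BB -> 0 <= mu B.
Hypothesis Hmu : forall B, B \in BB ->
  PO p B * \sum_(Y in powerset BB | orderable B Y) \prod_(B' in Y) mu B' <= mu B.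
Local Notation node := (N.-bseq (event I V)).
Local Notation tree := {set node}.
Implicit Types (x y : assignment I V) (tau : tree) (B C Q : event I V).

Definition draw_prob x : R := \prod_i p i (x i).

Lemma draw_prob_ge0 x : 0 <= draw_prob x.
Proof. exact: prodr_ge0. Qed.

Lemma sum_draw_prob : \sum_x draw_prob x = 1.
Proof.
by rewrite -(bigA_distr_bigA p) big1 // => i _; apply: p_sum1.
Qed.

Lemma p_le1 i j : p i j <= 1.
Proof. by rewrite -(p_sum1 i) (bigD1 j) //= lerDl sumr_ge0. Qed.

Lemma prod_event (F : I * V -> R) (P : pred (I * V)) :
  \prod_(z | P z) F z = \prod_i \prod_(j | P (i, j)) F (i, j).
Proof. by rewrite pair_big_dep /=; apply: eq_big => [[]|[]]. Qed.

Definition mix (S : pred I) x y : assignment I V := [ffun i => if S i then y i else x i].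

(** Both sides factor over the variables, the fresh values being independent; by atomicity each
    variable occurs in at most one pair of [Q]. *)
Lemma sum_holds_mix (S : pred I) x Q : atomic Q ->
  \sum_y draw_prob y * (holds (mix S x y) Q)%:R =
  \prod_(z in Q | S z.1) p z.1 z.2 * (holds x [set z in Q | ~~ S z.1])%:R.
Proof.
move=> Qat.
rewrite /holds !forall_in_prod !prod_event -big_split /=.
pose F i j : R := p i j * \prod_(j' | (i, j') \in Q) ((if S i then j else x i) == j')%:R.
rewrite (eq_bigr (fun y : assignment I V => \prod_i F i (y i))); last first.
  move=> y _; rewrite forall_in_prod prod_event -big_split /=; apply: eq_bigr => i _.
  by congr (_ * _); apply: eq_bigr => j _; rewrite ffunE.
rewrite -(bigA_distr_bigA F); apply: eq_bigr => i _; rewrite /F.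
have [Si|Si] := boolP (S i); last first.
  rewrite -mulr_suml p_sum1 mul1r [X in _ = X * _]big_pred0 ?mul1r; last first.
    by move=> j; rewrite andbF.
  by apply: eq_bigl => j; rewrite inE /= Si andbT.
rewrite [X in _ = _ * X]big_pred0 ?mulr1; last by move=> j; rewrite inE /= Si andbF.
under [RHS]eq_bigl do rewrite andbT.
have [/existsP[j0 ij0]|none] := boolP [exists j, (i, j) \in Q].
  have E j : ((i, j) \in Q) = (j == j0).
    by apply/idP/eqP => [ij|-> //]; apply: atomic_inj Qat ij ij0.
  rewrite [RHS](big_pred1 j0) // (bigD1 j0) //= (big_pred1 j0) // eqxx mulr1.
  rewrite big1 ?addr0 // => j jj0.
  by rewrite (big_pred1 j0) // (negPf jj0) mulr0.
have no j : ((i, j) \in Q) = false.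
  by apply: contraNF none => ij; apply/existsP; exists j.
rewrite [RHS]big_pred0 // -[RHS](p_sum1 i); apply: eq_bigr => j _.
by rewrite big_pred0 // mulr1.
Qed.

(* Division by a vanishing [PO p (req tau)] gives the junk value 0; this is
   harmless as only states of positive probability are considered. *)
Definition tree_potential tau x : R :=
  tweight p tau / PO p (req tau) * (holds x (req tau))%:R.

Definition potential n B x : R := \sum_(tau | witness BB n B tau) tree_potential tau x.

Lemma tree_potential_ge0 tau x : 0 <= tree_potential tau x.
Proof. by rewrite mulr_ge0 ?divr_ge0 ?tweight_ge0 ?PO_ge0. Qed.

Lemma PO_neq0 x C : (forall i, p i (x i) != 0) -> holds x C -> PO p C != 0.
Proof.
move=> x0 /forall_inP xC; rewrite /PO prodf_seq_neq0; apply/allP => z _.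
by apply/implyP => /xC /eqP <-; apply: x0.
Qed.

(** The required pairs on variables of [C] are redrawn, and their probability [a] cancels against
    the denominator; the others, [Qo], must hold in [x] already. As [C] holds in [x] too, so do all
    requirements of [insert tau C]. *)
Lemma tree_potential_step n B tau x C :
    (n < N)%N -> (forall i, p i (x i) != 0) -> C \in BB -> holds x C -> witness BB n B tau ->
  \sum_y draw_prob y * tree_potential tau (resample x C y)
    <= tree_potential (insert tau C) x.
Proof.
move=> nN x0 CB xC /andP[tW Qat].
pose S i := mentions i C; pose Qo := [set z in req tau | ~~ S z.1].
have -> : \sum_y draw_prob y * tree_potential tau (resample x C y) =
    tweight p tau / PO p (req tau) *
    (\prod_(z in req tau | S z.1) p z.1 z.2 * (holds x Qo)%:R).
  rewrite -(sum_holds_mix S x Qat) mulr_sumr; apply: eq_bigr => y _.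
  by rewrite mulrCA.
have QE : PO p (req tau) = \prod_(z in req tau | S z.1) p z.1 z.2 * PO p Qo.
  rewrite /PO (bigID (fun z => S z.1)) /=; congr (_ * _).
  by apply: eq_bigl => z; rewrite [in RHS]inE.
rewrite QE; set a := \prod_(z in _ | _) _.
have a0 : 0 <= a by apply: prodr_ge0.
have a1 : a <= 1 by apply: prodr_ile1 => z _; rewrite p_ge0 p_le1.
have [->|an0] := eqVneq a 0; first by rewrite !mul0r mulr0 tree_potential_ge0.
have -> : tweight p tau / (a * PO p Qo) * (a * (holds x Qo)%:R) =
          tweight p tau / PO p Qo * (holds x Qo)%:R.
  by rewrite mulrA invfM -[_ * a]mulrA [_ / _ * a]mulrAC mulVf ?mul1r.
have [xQo|_] := boolP (holds x Qo); last by rewrite mulr0 tree_potential_ge0.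
rewrite mulr1 /tree_potential.
case: insertP => [no|v vE vm].
  (* Nothing is inserted: the requirements on variables of [C] lie in [C], and the extra factor
     [a <= 1] in the denominator only raises the right side. *)
  have -> : holds x (req tau).
    apply/forall_inP => z zQ; have [zC|zC] := boolP (mentions z.1 C).
      exact: (forall_inP xC) (req_not_eligible tW nN no zQ zC).
    by apply: (forall_inP xQo); rewrite inE zQ.
  rewrite mulr1 QE invfM ler_wpM2l ?tweight_ge0 // ler_peMl ?invr_ge0 ?PO_ge0 //.
  by rewrite invf_ge1 // lt0r an0.
(* The new node multiplies both the weight and the probability of the requirements by [PO p C],
   nonzero since [x] has positive probability. *)
have tv : tweight p (child C v |: tau) = PO p C * tweight p tau.
  case/and3P: vE => vt; rewrite inE => Cv _.
  rewrite /tweight big_setU1 //= label_child //.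
  by case/andP: (wtree_size tW vt) => _ vn; apply: leq_ltn_trans nN.
rewrite (req_ins tW) // -/Qo tv.
have -> : holds x (C :|: Qo).
  by apply/forall_inP => z /setUP[]; [apply: (forall_inP xC)|apply: (forall_inP xQo)].
have -> : PO p (C :|: Qo) = PO p C * PO p Qo.
  rewrite -bigU /=; first by apply: eq_bigl => z; rewrite in_setU.
  by apply/pred0P => z /=; rewrite inE; apply/negP => /and3P[/mem_mentions zC _ /negP].
by rewrite mulr1 invfM mulrACA divff ?mul1r // (PO_neq0 x0).
Qed.

(** Insertion of [C] injects the trees of height at most [n] into those of height at most [n.+1].
    When [C] is [B], it misses the single root, whose potential at [x] is exactly 1. *)
Lemma potential_step n B x C :
    (n < N)%N -> B \in BB -> (forall i, p i (x i) != 0) -> C \in BB -> holds x C ->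
  (C == B)%:R + \sum_y draw_prob y * potential n B (resample x C y)
    <= potential n.+1 B x.
Proof.
move=> nN BB_B x0 CB xC; have N0 : (0 < N)%N by apply: leq_ltn_trans nN.
have -> : \sum_y draw_prob y * potential n B (resample x C y) =
    \sum_(tau | witness BB n B tau)
      \sum_y draw_prob y * tree_potential tau (resample x C y).
  by rewrite exchange_big; apply: eq_bigr => y _; rewrite mulr_sumr.
have inj : {in witness BB n B &, injective (fun tau : tree => insert tau C)}.
  by move=> t t' /andP[tW _] /andP[tW' _]; apply: insert_inj nN tW tW'.
have insW (t : tree) : witness BB n B t -> witness BB n.+1 B (insert t C).
  by move=> tW; exact: (witness_ins BB_atomic nN CB tW).
have [e|CneB] := eqVneq C B.
  rewrite /potential [leRHS](bigD1 [set root_node N B]) ?witness_leaf //=.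
  apply: lerD.
    rewrite /tree_potential req_leaf // /tweight big_set1 /label val_root_node //=.
    by rewrite -e xC mulr1 divff // (PO_neq0 x0).
  apply: (ler_sum_inj (fun tau : tree => insert tau C)) => //.
  - move=> t W; rewrite insW //= e; case/andP: W => tW _.
    exact: insert_neq_leaf nN tW.
  - by move=> t tW; apply: tree_potential_step tW.
  - by move=> t _; apply: tree_potential_ge0.
rewrite add0r; apply: (ler_sum_inj (fun tau : tree => insert tau C)) => //.
- by move=> t tW; apply: tree_potential_step tW.
- by move=> t _; apply: tree_potential_ge0.
Qed.

Lemma potentialS n B x : potential n B x <= potential n.+1 B x.
Proof.
apply: (ler_sum_inj id) => // [tau|tau _]; first exact: witnessS.
exact: tree_potential_ge0.
Qed.

Lemma potential_ge0 n B x : 0 <= potential n B x.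
Proof. by apply: sumr_ge0 => tau _; apply: tree_potential_ge0. Qed.

Lemma sum_holds Q : atomic Q -> \sum_y draw_prob y * (holds y Q)%:R <= PO p Q.
Proof.
(* [mix] needs a base assignment; if there is none, the sum is empty. *)
move=> Qat; have [x _|none] := pickP (@predT (assignment I V)); last first.
  by rewrite big_pred0 ?PO_ge0 // => y; have := none y.
have -> : PO p Q = \prod_(z in Q | predT z.1) p z.1 z.2 *
    (holds x [set z in Q | ~~ predT z.1])%:R.
  have -> : holds x [set z in Q | ~~ predT z.1].
    by apply/forall_inP => z; rewrite inE andbF.
  rewrite mulr1.
  by apply: eq_bigl => z; rewrite andbT.
rewrite -sum_holds_mix // le_eqVlt; apply/orP; left; apply/eqP.
apply: eq_bigr => y _; congr (_ * (holds _ _)%:R).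
by apply/ffunP => i; rewrite ffunE.
Qed.

(** In a fresh draw the requirements of a tree hold with probability at most [PO p (req tau)], which
    cancels the denominator and leaves the weight of the tree. *)
Lemma sum_potential n B : (n < N)%N -> B \in BB ->
  \sum_y draw_prob y * potential n B y <= mu B.
Proof.
move=> nN BB_B; apply: le_trans (sum_tweight p_ge0 mu_ge0 Hmu nN BB_B).
under eq_bigr do rewrite mulr_sumr.
rewrite exchange_big /=; apply: (ler_sum_inj id) => //.
- by move=> tau /andP[].
- move=> tau /andP[_ Qat].
  under eq_bigr do rewrite mulrCA.
  rewrite -mulr_sumr; have [e|ne] := eqVneq (PO p (req tau)) 0.
    by rewrite e invr0 mulr0 mul0r tweight_ge0.
  rewrite -mulrA ler_piMr ?tweight_ge0 //.
  by rewrite ler_pdivrMl ?mulr1 ?sum_holds // lt0r ne PO_ge0.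
by move=> tau _; apply: tweight_ge0.
Qed.

End Potential.

(** * Redrawing one of several independent draws *)

Section Draws.
Set Implicit Arguments.
Unset Strict Implicit.
Variables (R : comNzRingType) (A : finType) (W : A -> R).
Hypothesis W_sum1 : \sum_a W a = 1.
Variable n : nat.
Implicit Types (r : {ffun 'I_n -> A}) (k : 'I_n).

Definition upd r k a : {ffun 'I_n -> A} := [ffun j => if j == k then a else r j].

(** Exchanging draw [k] with an independent extra draw [a] preserves the product weight. This serves
    as conditioning on all draws other than [k]. *)
Lemma sum_upd k (f : {ffun 'I_n -> A} -> R) :
  \sum_(r : {ffun 'I_n -> A}) (\prod_j W (r j)) * f r =
  \sum_(r : {ffun 'I_n -> A}) (\prod_j W (r j)) * \sum_a W a * f (upd r k a).
Proof.
pose H (u : {ffun 'I_n -> A} * A) := W u.2 * (\prod_j W (u.1 j)) * f u.1.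
pose phi (u : {ffun 'I_n -> A} * A) := (upd u.1 k u.2, u.1 k).
have phiK : involutive phi.
  case=> r a; rewrite /phi /= ffunE eqxx; congr pair.
  by apply/ffunP => j; rewrite !ffunE; case: eqP => [->|].
transitivity (\sum_u H u).
  rewrite -(pair_bigA _ (fun r a => H (r, a))) /=; apply: eq_bigr => r _.
  by rewrite /H /= -!mulr_suml W_sum1 mul1r.
rewrite (reindex_inj (inv_inj phiK)) /=.
rewrite -(pair_bigA _ (fun r a => H (phi (r, a)))) /=; apply: eq_bigr => r _.
rewrite mulr_sumr; apply: eq_bigr => a _; rewrite /H /= mulrA; congr (_ * _).
rewrite (bigD1 k) //= [in RHS](bigD1 k) //= ffunE eqxx -mulrA.
congr (_ * _); rewrite [RHS]mulrC; congr (_ * _).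
by apply: eq_bigr => j jk; rewrite ffunE (negPf jk).
Qed.

End Draws.

(** * Runs of the algorithm: expected resamplings and termination *)

Section Process.
Set Implicit Arguments.
Unset Strict Implicit.
Variables (I V : finType) (R : archiRealFieldType) (p : I -> V -> R).
Hypothesis p_ge0 : forall i j, 0 <= p i j.
Hypothesis p_sum1 : forall i, \sum_(j : V) p i j = 1.
Variables (BB : {set event I V}) (mu : event I V -> R).
Hypothesis BB_atomic : forall B, B \in BB -> atomic B.
Hypothesis mu_ge0 : forall B, B \in BB -> 0 <= mu B.
Hypothesis Hmu : forall B, B \in BB ->
  PO p B * \sum_(Y in powerset BB | orderable B Y) \prod_(B' in Y) mu B' <= mu B.
Variable sel : seq (assignment I V) -> event I V.
Hypothesis sel_ok : forall (x : assignment I V) h, some_bad BB x ->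
  sel (x :: h) \in BB /\ holds x (sel (x :: h)).
Implicit Types (r : nat -> assignment I V) (B : event I V).

Local Notation hist := (hist BB sel).
Local Notation cur := (cur BB sel).

Lemma hist_cur r k : hist r k = cur r k :: behead (hist r k).
Proof. by rewrite /cur; case: k => //= k; case: ifP. Qed.

Lemma curS r k : cur r k.+1 =
  if some_bad BB (cur r k) then resample (cur r k) (sel (hist r k)) (r k.+1) else cur r k.
Proof. by rewrite /cur /=; case: ifP. Qed.

Lemma sel_hist r k : some_bad BB (cur r k) ->
  sel (hist r k) \in BB /\ holds (cur r k) (sel (hist r k)).
Proof. by move=> bad; rewrite hist_cur; apply: sel_ok. Qed.

Lemma eq_hist r r' k : (forall j, (j <= k)%N -> r j = r' j) -> hist r k = hist r' k.
Proof.
elim: k => [|k IH] e /=; first by rewrite e.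
by rewrite IH => [|j jk]; rewrite ?e // ltnW.
Qed.

Lemma eq_cur r r' k : (forall j, (j <= k)%N -> r j = r' j) -> cur r k = cur r' k.
Proof. by move=> e; rewrite /cur (eq_hist e) e. Qed.

Lemma cur_pos r T : (forall k i, (k <= T)%N -> p i (r k i) != 0) ->
  forall k i, (k <= T)%N -> p i (cur r k i) != 0.
Proof.
move=> r0; elim=> [|k IH] i kT; first exact: r0.
rewrite curS; case: ifP => _; last exact/IH/ltnW.
by rewrite ffunE; case: ifP => _; [apply: r0|exact/IH/ltnW].
Qed.

Lemma count_resS r B k : count_res BB sel r B k.+1 =
  (count_res BB sel r B k + (some_bad BB (cur r k) && (sel (hist r k) == B)))%N.
Proof. by rewrite /count_res big_ord_recr. Qed.

Lemma eq_count_res r r' B k : (forall j, (j < k)%N -> r j = r' j) ->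
  count_res BB sel r B k = count_res BB sel r' B k.
Proof.
move=> e; apply: eq_bigr => j _.
have ej l : (l <= j)%N -> r l = r' l by move=> lj; apply/e/(leq_ltn_trans lj)/ltn_ord.
by rewrite (eq_cur ej) (eq_hist ej).
Qed.

Lemma weightE T (r : {ffun 'I_T.+1 -> assignment I V}) :
  weight p r = \prod_k draw_prob p (r k).
Proof. by []. Qed.

Lemma weight_ge0 T (r : {ffun 'I_T.+1 -> assignment I V}) : 0 <= weight p r.
Proof. by apply: prodr_ge0 => k _; apply: draw_prob_ge0. Qed.

Lemma sum_weight T : \sum_(r : {ffun 'I_T.+1 -> assignment I V}) weight p r = 1.
Proof.
rewrite -(bigA_distr_bigA (fun=> draw_prob p)) big1 // => k _.
exact: sum_draw_prob.
Qed.

Section Horizon.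
Variables (T : nat) (B : event I V).
Hypothesis BB_B : B \in BB.
Local Notation pot := (@potential I V T.+1 R p BB).
Local Notation run := {ffun 'I_T.+1 -> assignment I V}.

(** The height bound of the potential is the number of steps left, since each step may deepen a tree
    by one level; the bound [T.+1] on paths always exceeds it. *)
Definition progress k r : R :=
  (count_res BB sel r B k)%:R + pot (T - k) B (cur r k).

Lemma draws_upd (r : run) k y j : (j < k)%N -> (k <= T)%N ->
  draws (upd r (inord k) y) j = draws r j.
Proof.
move=> jk kT; rewrite /draws ffunE; case: eqP => // /(congr1 (@nat_of_ord _)).
rewrite !inordK ?ltnS // => [jk'|]; first by rewrite jk' ltnn in jk.
exact: leq_trans (ltnW jk) kT.
Qed.

(** Nothing up to time [k] depends on draw [k.+1], so this draw is averaged first; [potential_step]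
    then applies if the run continues, and monotonicity in the height if it has stopped. *)
Lemma progress_step k : (k < T)%N ->
  \sum_(r : run) weight p r * progress k.+1 (draws r) <=
  \sum_(r : run) weight p r * progress k (draws r).
Proof.
move=> kT.
rewrite (sum_upd (sum_draw_prob p_sum1) (inord k.+1) (fun q : run => progress k.+1 (draws q))).
apply: ler_sum => r _; rewrite -weightE.
(* Runs of weight zero contribute nothing; in all others every drawn value has nonzero
   probability. *)
have [->|wr] := eqVneq (weight p r) 0; first by rewrite !mul0r.
apply: ler_wpM2l; first exact: weight_ge0.
have pos i : p i (cur (draws r) k i) != 0.
  apply: (cur_pos (T := T)) => [j i' jT|]; last exact: ltnW.
  move: wr; rewrite /weight prodf_seq_neq0 => /allP/(_ (inord j)).
  rewrite mem_index_enum implyTb => /(_ isT).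
  by rewrite prodf_seq_neq0 => /allP/(_ i'); rewrite mem_index_enum implyTb => /(_ isT).
set x := cur (draws r) k; set h := hist (draws r) k.
pose res : nat := some_bad BB x && (sel h == B).
have -> : \sum_y draw_prob p y * progress k.+1 (draws (upd r (inord k.+1) y)) =
    (count_res BB sel (draws r) B k)%:R + (res%:R +
    \sum_y draw_prob p y *
       pot (T - k.+1) B (if some_bad BB x then resample x (sel h) y else x)).
  rewrite addrA -natrD; set c := (_ + _)%:R.
  rewrite -[c]mul1r -(sum_draw_prob p_sum1) mulr_suml -big_split.
  apply: eq_bigr => y _ /=.
  have ed j : (j <= k)%N -> draws (upd r (inord k.+1) y) j = draws r j.
    by move=> jk; rewrite draws_upd.
  rewrite -mulrDr /progress count_resS curS (eq_hist ed) (eq_cur ed).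
  rewrite (@eq_count_res _ (draws r)) => [|j jk]; last exact/ed/ltnW.
  by rewrite /draws ffunE eqxx.
rewrite /progress -/x lerD2l -[(T - k)%N]subnSK //.
have [bad|ok] := boolP (some_bad BB x).
  have [selB xsel] := sel_hist bad.
  have nT : (T - k.+1 < T.+1)%N by rewrite ltnS leq_subr.
  rewrite /res bad /=.
  exact: (potential_step p_ge0 p_sum1 BB_atomic nT BB_B pos selB xsel).
by rewrite /res (negPf ok) add0r -mulr_suml sum_draw_prob // mul1r potentialS.
Qed.

Lemma expected_resamplings : Exp p T (fun r => count_res BB sel r B T) <= mu B.
Proof.
have H k : (k <= T)%N -> \sum_(r : run) weight p r * progress k (draws r) <= mu B.
  elim: k => [_|k IH kT]; last exact: le_trans (progress_step kT) (IH (ltnW kT)).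
  (* Redrawing draw 0 makes the initial state a fresh draw, to which [sum_potential] applies. *)
  rewrite (sum_upd (sum_draw_prob p_sum1) ord0 (fun q : run => progress 0 (draws q))).
  apply: (@le_trans _ _ (\sum_(r : run) weight p r * mu B)); last first.
    by rewrite -mulr_suml sum_weight mul1r.
  apply: ler_sum => r _; apply: ler_wpM2l; first exact: weight_ge0.
  have := sum_potential p_ge0 p_sum1 mu_ge0 Hmu (ltnSn T) BB_B.
  apply: le_trans; apply: ler_sum => y _.
  rewrite /progress subn0 /count_res big_ord0 add0r /cur /= /draws ffunE.
  by rewrite (_ : inord 0 = ord0) ?eqxx //; apply: val_inj; rewrite /= inordK.
apply: le_trans (H T (leqnn T)); apply: ler_sum => r _.
by rewrite ler_wpM2l ?weight_ge0 // /progress lerDl potential_ge0.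
Qed.

End Horizon.

Lemma runningS r k : running BB sel r k.+1 -> running BB sel r k.
Proof. by rewrite /running curS; case: ifP => // ->. Qed.

Lemma running_le r k T : (k <= T)%N -> running BB sel r T -> running BB sel r k.
Proof.
elim: T => [|T IH]; first by rewrite leqn0 => /eqP ->.
by rewrite leq_eqVlt => /predU1P[-> //|kT /runningS]; apply: IH.
Qed.

(** A run still active at time [T] has resampled one bad-event at each of the [T] earlier steps. *)
Lemma running_count r T :
  (T * running BB sel r T <= \sum_(B in BB) count_res BB sel r B T)%N.
Proof.
rewrite exchange_big /= -{1}(card_ord T) -sum_nat_const.
apply: leq_sum => k _; case: (boolP (running _ _ _ _)) => // runT.
have runk : running BB sel r k by apply: running_le runT; apply: ltnW.
have [selB _] := sel_hist runk.
by rewrite (bigD1 (sel (hist r k))) //= eqxx andbT -[some_bad _ _]/(running BB sel r k) runk.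
Qed.

Lemma expected_running T :
  T%:R * Exp p T (fun r => running BB sel r T) <= \sum_(B in BB) mu B.
Proof.
apply: (@le_trans _ _ (\sum_(B in BB) Exp p T (fun r => count_res BB sel r B T))); last first.
  by apply: ler_sum => B; apply: expected_resamplings.
rewrite exchange_big /= mulr_sumr; apply: ler_sum => r _.
rewrite -mulr_sumr mulrCA ler_wpM2l ?weight_ge0 //.
by rewrite -natrM -natr_sum ler_nat running_count.
Qed.

(** By [expected_running], the probability of still running at a time [T > 0] is at most the sum of
    all [mu B] divided by [T]. *)
Lemma almost_sure_termination (eps : R) : 0 < eps ->
  exists T0 : nat, forall T : nat, (T0 <= T)%N ->
    Exp p T (fun r => running BB sel r T) <= eps.
Proof.
move=> eps0; pose M := \sum_(B in BB) mu B.
have M0 : 0 <= M / eps by rewrite divr_ge0 ?sumr_ge0 // ltW.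
exists (Num.bound (M / eps)) => T T0T.
have MT : M / eps < T%:R by apply: lt_le_trans (archi_boundP M0) _; rewrite ler_nat.
have T_gt0 : 0 < T%:R :> R by apply: le_lt_trans MT.
rewrite -(ler_pM2l T_gt0); apply: le_trans (expected_running T) _.
by rewrite -ler_pdivrMr // ltW.
Qed.

End Process.

Theorem theorem1p1 (I V : finType) (R : archiRealFieldType)
    (p : I -> V -> R)
    (p_ge0 : forall i j, 0 <= p i j)
    (p_sum1 : forall i, \sum_(j : V) p i j = 1)
    (BB : {set event I V})
    (BB_atomic : forall B, B \in BB -> atomic B)
    (mu : event I V -> R)
    (mu_ge0 : forall B, B \in BB -> 0 <= mu B)
    (Hmu : forall B, B \in BB ->
       PO p B * \sum_(Y in powerset BB | orderable B Y) \prod_(B' in Y) mu B'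
         <= mu B)
    (sel : seq (assignment I V) -> event I V)
    (sel_ok : forall (x : assignment I V) h, some_bad BB x ->
       sel (x :: h) \in BB /\ holds x (sel (x :: h))) :
  (* termination with probability 1 *)
  (forall eps : R, 0 < eps -> exists T0 : nat, forall T : nat, (T0 <= T)%N ->
     Exp p T (fun r => running BB sel r T) <= eps)
  /\
  (* expected number of resamplings of B is at most mu B *)
  (forall B, B \in BB -> forall T : nat,
     Exp p T (fun r => count_res BB sel r B T) <= mu B).
Proof.
split; first exact: (almost_sure_termination p_ge0 p_sum1 BB_atomic mu_ge0 Hmu sel_ok).
move=> B BB_B T.
exact: (expected_resamplings p_ge0 p_sum1 BB_atomic mu_ge0 Hmu sel_ok T BB_B).
Qed.
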